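(* There exist a $C^*$-algebra $\mathfrak{A}$, a Hilbert $\mathfrak{A}$-module $H$ and projections $P,Q\in\mathcal{L}(H)$ such that the pair $(P,Q)$ is semi-harmonious but not harmonious.
   Context: For a Hilbert $C^*$-module $H$, $\mathcal{L}(H)$ denotes the $C^*$-algebra of all adjointable operators on $H$, and $I$ its unit. A projection is $P\in\mathcal{L}(H)$ with $P=P^*=P^2$. $\mathcal{R}(T)$ denotes the range of $T$, and $\overline{\mathcal{R}(T)}$ its norm closure. A closed submodule $M\subseteq H$ is orthogonally complemented in $H$ if $H=M+M^\perp$, where $M^\perp=\{x\in H:\langle x,y\rangle=0\ \forall y\in M\}$. A pair $(P,Q)$ of projections on $H$ is semi-harmonious if both $\overline{\mathcal{R}(P+Q)}$ and $\overline{\mathcal{R}(2I-P-Q)}$ are orthogonally complemented in $H$. It is harmonious if both $(P,Q)$ and $(P,I-Q)$ are semi-harmonious. *)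

(* Defs.v *)
From HB Require Import structures.
From mathcomp Require Import all_boot all_order all_algebra.
From mathcomp Require Import all_classical all_reals all_analysis.
From mathcomp Require Import complex.

Set Implicit Arguments.
Unset Strict Implicit.
Unset Printing Implicit Defensive.

Import Order.TTheory GRing.Theory Num.Theory.
Import numFieldNormedType.Exports.

Local Open Scope classical_set_scope.
Local Open Scope ring_scope.
Local Open Scope complex_scope.

(* C*-algebras need not have a unit, so the product is not inherited from
   MathComp's (unital) algType. The norm takes its values in R[i], as for every
   normedModType over R[i]; these values are nonnegative, hence real. *)
HB.mixin Record isCStarAlgebra (R : realType) A
    of CompleteNormedModule R[i] A := {
  cmul : A -> A -> A;
  cstar : A -> A;
  cmulA : forall a b c, cmul a (cmul b c) = cmul (cmul a b) c;
  cmulDl : forall a b c, cmul (a + b) c = cmul a c + cmul b c;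
  cmulDr : forall a b c, cmul a (b + c) = cmul a b + cmul a c;
  cmulZl : forall (k : R[i]) a b, cmul (k *: a) b = k *: cmul a b;
  cmulZr : forall (k : R[i]) a b, cmul a (k *: b) = k *: cmul a b;
  cstarK : forall a, cstar (cstar a) = a;
  cstarD : forall a b, cstar (a + b) = cstar a + cstar b;
  cstarZ : forall (k : R[i]) a, cstar (k *: a) = Num.conj k *: cstar a;
  cstarM : forall a b, cstar (cmul a b) = cmul (cstar b) (cstar a);
  cnormM : forall a b, `|cmul a b| <= `|a| * `|b|;
  cnorm_star : forall a, `|cmul (cstar a) a| = `|a| ^+ 2
}.

#[short(type="cstarAlgType")]
HB.structure Definition CStarAlgebra (R : realType) :=
  {A of isCStarAlgebra R A & CompleteNormedModule R[i] A}.

Definition cpositive (R : realType) (A : cstarAlgType R) (a : A) : Prop :=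
  exists b : A, a = cmul (cstar b) b.

(* Right modules, with inner product linear in the second variable. *)
HB.mixin Record isHilbertModule (R : realType) (A : cstarAlgType R) H
    of CompleteNormedModule R[i] H := {
  ract : H -> A -> H;
  inner : H -> H -> A;
  ractDl : forall x y a, ract (x + y) a = ract x a + ract y a;
  ractDr : forall x a b, ract x (a + b) = ract x a + ract x b;
  ractM : forall x a b, ract x (cmul a b) = ract (ract x a) b;
  ractZl : forall (k : R[i]) x a, ract (k *: x) a = k *: ract x a;
  ractZr : forall (k : R[i]) x a, ract x (k *: a) = k *: ract x a;
  innerDr : forall x y z, inner x (y + z) = inner x y + inner x z;
  innerZr : forall (k : R[i]) x y, inner x (k *: y) = k *: inner x y;
  inner_ract : forall x y a, inner x (ract y a) = cmul (inner x y) a;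
  inner_star : forall x y, cstar (inner x y) = inner y x;
  inner_ge0 : forall x, cpositive (inner x x);
  inner_eq0 : forall x, inner x x = 0 -> x = 0;
  norm_inner : forall x, `|x| ^+ 2 = `|inner x x|
}.

#[short(type="hilbertModType")]
HB.structure Definition HilbertModule (R : realType) (A : cstarAlgType R) :=
  {H of isHilbertModule R A H & CompleteNormedModule R[i] H}.

Section Operators.
Context (R : realType) (A : cstarAlgType R) (H : hilbertModType A).
Implicit Types (T S P Q : H -> H) (M : set H).

Definition is_adjoint T S : Prop :=
  forall x y, inner (T x) y = inner x (S y) :> A.

Definition adjointable T : Prop := exists S, is_adjoint T S.

Definition projection P : Prop :=
  [/\ adjointable P, is_adjoint P P & P \o P = P].

Definition orthogonal_complement M : set H :=
  [set x | forall y, M y -> inner x y = 0 :> A].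

Definition orthogonally_complemented M : Prop :=
  [set y + z | y in M & z in orthogonal_complement M] = setT.

Definition semi_harmonious P Q : Prop :=
  orthogonally_complemented (closure (range (P + Q))) /\
  orthogonally_complemented (closure (range (idfun *+ 2 - P - Q))).

Definition harmonious P Q : Prop :=
  semi_harmonious P Q /\ semi_harmonious P (idfun - Q).

End Operators.

(* Main.v *)
Require Import Defs.
From HB Require Import structures.
From mathcomp Require Import all_boot all_order all_algebra.
From mathcomp Require Import all_classical all_reals all_analysis.
From mathcomp Require Import complex spectral sesquilinear ring.

(** The coefficient algebra is A = l^oo(nat, C) and the module is
    H = l^oo(nat, C^2), with fibrewise operations and the supremum of the fibre
    norms. A bounded sequence of matrices acts on H fibre by fibre. Let P_n be
    the projection onto the line C(1,0) for every n, and Q_n the projection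
    onto the line C(s_n,1), where s_n = 1/(n+1).

    The two lines stay uniformly apart: their angle lies between pi/4 and pi/2.
    Hence P_n + Q_n and 2 - P_n - Q_n have inverses that are bounded in n (with
    entries polynomial in s_n), P + Q and 2I - P - Q are onto, and (P, Q) is
    semi-harmonious ([sum_range_onto], [cosum_range_onto]).

    The two lines become orthogonal in the limit, and this breaks the pair
    (P, I - Q). The operator S = P + (I - Q) is self-adjoint and injective, as
    each S_n is invertible ([cross_inj0]); so only 0 is orthogonal to its range.
    But S_n tends to 2P_0, so the second coordinate of S x tends to 0 for every
    bounded x ([ler_cross]). The constant sequence (0,1) is therefore at
    distance at least 1 from the range of S. If the closure of that range were
    complemented, it would be all of H and would contain this sequence.

    Most of the work is the construction of A and H. Completeness is obtained in
    three steps: C from its real and imaginary parts, C^d from its coordinates,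
    and the bounded functions into a complete space from their values. *)

Set Implicit Arguments.
Unset Strict Implicit.
Unset Printing Implicit Defensive.

Import Order.TTheory GRing.Theory Num.Theory.
Import numFieldNormedType.Exports.

Local Open Scope classical_set_scope.
Local Open Scope ring_scope.
Local Open Scope complex_scope.

(** * Completeness of the complex line *)

(** The two spaces may be normed over different fields, so that the lemma covers
    the real and imaginary parts of a complex number. *)
Lemma cauchy_image (K K' : numFieldType) (U : pseudoMetricType K)
    (V : pseudoMetricType K') (f : U -> V) (F : set_system U) :
  ProperFilter F ->
  (forall e : K', 0 < e ->
    exists2 d : K, 0 < d & forall x y, ball x d y -> ball (f x) e (f y)) ->
  cauchy F -> cauchy (f @ F).
Proof.
move=> FF fU /cauchy_ballP cF; apply/cauchy_ballP => e e0.
have [d d0 fd] := fU e e0.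
have [[A B] /= [FA FB] AB] := cF d d0.
exists (f @` A, f @` B).
  by split; [apply: filterS FA|apply: filterS FB] => x Ax; exists x.
by move=> [_ _] [/= [x Ax <-] [y By <-]]; apply/fd/(AB (x, y)).
Qed.

Section ComplexComplete.
Variable R : realType.

(** A separate name for the line [R[i]^o], which carries its completeness. *)
Definition complex_line : Type := R[i]^o.
HB.instance Definition _ := NormedModule.copy complex_line R[i]^o.

Lemma complex_cauchy_cvg (F : set_system complex_line) :
  ProperFilter F -> cauchy F -> cvg F.
Proof.
move=> FF cF.
pose re (z : complex_line) : R := complex.Re (z : R[i]).
pose im (z : complex_line) : R := complex.Im (z : R[i]).
have ri (z : complex_line) :
    `|re z| <= complex.Re `|z| /\ `|im z| <= complex.Re `|z|.
  rewrite -[`|z|]/(`|z : R[i]|) normc_def /=; split.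
    by rewrite -sqrtr_sqr ler_wsqrtr// lerDl sqr_ge0.
  by rewrite -sqrtr_sqr ler_wsqrtr// lerDr sqr_ge0.
have rD x y : re (x - y) = re x - re y by exact: raddfB.
have iD x y : im (x - y) = im x - im y by exact: raddfB.
have ltRe (z : R[i]) (e : R) : z < e%:C -> complex.Re z < e.
  by rewrite ltcE => /andP[].
have /cauchy_cvg/cvg_ex[a ra] : cauchy (re @ F).
  apply: cauchy_image cF => e e0; exists e%:C; first by rewrite ltcR.
  move=> x y; rewrite -!ball_normE/= => /ltRe; apply: le_lt_trans.
  by rewrite -rD; case: (ri (x - y)).
have /cauchy_cvg/cvg_ex[b ib] : cauchy (im @ F).
  apply: cauchy_image cF => e e0; exists e%:C; first by rewrite ltcR.
  move=> x y; rewrite -!ball_normE/= => /ltRe; apply: le_lt_trans.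
  by rewrite -iD; case: (ri (x - y)).
apply/cvg_ex; exists (a +i* b : complex_line); apply/cvgrPdist_lt => e e0.
have e2 : 0 < complex.Re e / 2.
  by rewrite divr_gt0//; move: e0; rewrite ltcE => /andP[].
move/cvgrPdist_lt/(_ _ e2) : ra => ra.
move/cvgrPdist_lt/(_ _ e2) : ib => ib.
near=> z.
rewrite -(RRe_real (gtr0_real e0)).
set w := _ - z.
rewrite -[`|w|]/(`|w : R[i]|) (complexE (w : R[i])).
apply: le_lt_trans (ler_normD _ _) _.
have ni : `|'i%C : R[i]| = 1 by rewrite normc_def /= expr0n expr1n add0r sqrtr1.
rewrite normrM ni mul1r (splitr (complex.Re e)) rmorphD/=.
apply: ltrD; rewrite normc_def /= expr0n addr0 sqrtr_sqr ltcR.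
  by rewrite -[complex.Re _]/(re w) rD; near: z.
by rewrite -[complex.Im _]/(im w) iD; near: z.
Unshelve. all: by end_near. Qed.

HB.instance Definition _ :=
  Uniform_isComplete.Build complex_line complex_cauchy_cvg.
End ComplexComplete.

(** * Bounded functions with the supremum norm *)

Section BoundedFunctions.
Variables (R : realType) (T : Type) (V : normedModType R[i]).

Definition bounded_map : {pred T -> V} :=
  fun f => `[< exists c : R[i], forall t, `|f t| <= c >].

Lemma bounded_mapP f :
  reflect (exists c : R[i], forall t, `|f t| <= c) (f \in bounded_map).
Proof. exact: asboolP. Qed.

Lemma bounded_map_submod : submod_closed bounded_map.
Proof.
split=> [|k f g /bounded_mapP[b fb] /bounded_mapP[c gc]].
  by apply/bounded_mapP; exists 0 => t; rewrite normr0.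
apply/bounded_mapP; exists (`|k| * b + c) => t.
by rewrite (le_trans (ler_normD _ _))// lerD// normrZ ler_wpM2l.
Qed.

HB.instance Definition _ :=
  GRing.isSubmodClosed.Build R[i] (T -> V) bounded_map bounded_map_submod.

Record linf :=
  Linf { linf_val :> T -> V; linf_bounded : linf_val \in bounded_map }.

HB.instance Definition _ := [isSub for linf_val].
HB.instance Definition _ := [Choice of linf by <:].
HB.instance Definition _ := [SubChoice_isSubLmodule of linf by <:].

Lemma linfP (f g : linf) : (forall t, f t = g t) -> f = g.
Proof. by move=> fg; apply/val_inj/funext. Qed.

Lemma linfDE (f g : linf) t : (f + g) t = f t + g t. Proof. by []. Qed.
Lemma linfNE (f : linf) t : (- f) t = - f t. Proof. by []. Qed.
Lemma linfZE k (f : linf) t : (k *: f) t = k *: f t. Proof. by []. Qed.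

(** The supremum is taken in [R], since [R[i]] is only partially ordered. On an
    empty [T] it is the supremum of the empty set, which is 0. *)
Definition linf_norm (f : linf) : R[i] :=
  (sup [set complex.Re `|f t| | t in [set: T]])%:C.

Lemma ler_linf_norm (f : linf) t : `|f t| <= linf_norm f.
Proof.
have [c fc] := bounded_mapP _ (linf_bounded f).
rewrite -(RRe_real (normr_real (f t))) lecR; apply: ub_le_sup; last by exists t.
exists (complex.Re c) => _ [u _ <-].
by have := fc u; rewrite lecE => /andP[].
Qed.

Lemma linf_norm_le (f : linf) c :
  0 <= c -> (forall t, `|f t| <= c) -> linf_norm f <= c.
Proof.
move=> c0 fc; rewrite -(RRe_real (ger0_real c0)) lecR.
have [-> | ne] := eqVneq [set complex.Re `|f t| | t in [set: T]] set0.
  by rewrite sup0; have := c0; rewrite lecE => /andP[].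
apply: ge_sup; first exact/set0P.
by move=> _ [u _ <-]; have := fc u; rewrite lecE => /andP[].
Qed.

Lemma linf_norm_ge0 (f : linf) : 0 <= linf_norm f.
Proof.
have [T0|/set0P[_ [t _ _]]] :=
  eqVneq [set complex.Re `|f t| | t in [set: T]] set0.
  by rewrite /linf_norm T0 sup0.
exact: le_trans (ler_linf_norm f t).
Qed.

Lemma linf_normD f g : linf_norm (f + g) <= linf_norm f + linf_norm g.
Proof.
apply: linf_norm_le => [|t]; first by rewrite addr_ge0 ?linf_norm_ge0.
by rewrite (le_trans (ler_normD _ _))// lerD ?ler_linf_norm.
Qed.

Lemma linf_normZ k f : linf_norm (k *: f) = `|k| * linf_norm f.
Proof.
have le l g : linf_norm (l *: g) <= `|l| * linf_norm g.
  apply: linf_norm_le => [|t]; first by rewrite mulr_ge0 ?linf_norm_ge0.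
  by rewrite normrZ ler_wpM2l ?ler_linf_norm.
apply/le_anti; rewrite le/=.
have [->|k0] := eqVneq k 0; first by rewrite normr0 mul0r linf_norm_ge0.
rewrite -ler_pdivlMl ?normr_gt0// -normfV.
by have := le k^-1 (k *: f); rewrite scalerK.
Qed.

Lemma linf_norm_eq0 f : linf_norm f = 0 -> f = 0.
Proof.
move=> f0; apply: linfP => t; apply/eqP.
by rewrite -normr_le0 -f0 ler_linf_norm.
Qed.

HB.instance Definition _ :=
  Lmodule_isNormed.Build R[i] linf linf_normD linf_normZ linf_norm_eq0.

Lemma ler_eval_linf (f : linf) t : `|f t| <= `|f|.
Proof. exact: ler_linf_norm. Qed.

Lemma linf_ler (f : linf) c : 0 <= c -> (forall t, `|f t| <= c) -> `|f| <= c.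
Proof. exact: linf_norm_le. Qed.

End BoundedFunctions.
Arguments linf {R} T V.

Section BoundedFunctionsComplete.
Variables (R : realType) (T : Type) (V : completeNormedModType R[i]).

(** The limit is taken value by value. If the [e]-ball of some [f] belongs to the
    filter, then all values of the limit are within [2 * e] of those of [f]: this
    bounds the limit and makes the convergence uniform. *)
Lemma linf_cauchy_cvg (F : set_system (linf T V)) :
  ProperFilter F -> cauchy F -> cvg F.
Proof.
move=> FF cF.
have ev t : cvg ((fun f : linf T V => f t) @ F).
  apply: cauchy_cvg; apply: cauchy_image cF => e e0; exists e => // f g.
  by rewrite -!ball_normE; apply: le_lt_trans; exact: ler_eval_linf (f - g) t.
pose l t := lim ((fun f : linf T V => f t) @ F).
have lF e (f : linf T V) : 0 < e -> F (ball f e) ->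
    forall t, `|l t - f t| <= 2 * e.
  move=> e0 Ff t; have /cvgrPdist_lt/(_ e e0) lt := ev t.
  have [g [fg gl]] := filter_ex (filterI Ff lt).
  rewrite -(subrKA (g t)) mulr_natl mulr2n (le_trans (ler_normD _ _))//.
  rewrite lerD// ltW// -normrN opprB; move: fg; rewrite -ball_normE.
  by apply: le_lt_trans; exact: ler_eval_linf (f - g) t.
have cF1 : cauchy_ex F by apply/cauchyP.
have lb : l \in @bounded_map R T V.
  have [f Ff] := cF1 1 ltr01.
  apply/bounded_mapP; exists (2 + `|f|) => t.
  rewrite -(subrK (f t) (l t)) (le_trans (ler_normD _ _))//.
  rewrite lerD ?ler_eval_linf//.
  by rewrite -[2]mulr1; exact: lF.
apply/cvg_ex; exists (Linf lb); apply/cvgrPdist_le => e e0.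
have e3 : 0 < e / 3 by rewrite divr_gt0.
have [f Ff] := cF1 _ e3.
apply: filterS (Ff) => g fg; apply: linf_ler => [|t]; first exact: ltW.
rewrite linfDE linfNE /= -(subrKA (f t)) (le_trans (ler_normD _ _))//.
have -> : e = 2 * (e / 3) + e / 3 by field.
rewrite lerD ?lF//.
rewrite ltW//; move: fg; rewrite -ball_normE.
by apply: le_lt_trans; exact: ler_eval_linf (f - g) t.
Qed.

HB.instance Definition _ :=
  Uniform_isComplete.Build (linf T V) linf_cauchy_cvg.
End BoundedFunctionsComplete.

(** * The Hermitian space C^d *)

Section HermitianSpace.
Variables (R : realType) (d : nat).

(** Row vectors already carry the maximum norm; under this name they carry the
    Euclidean norm. *)
Definition herm : Type := 'rV[R[i]]_d.
HB.instance Definition _ := GRing.Lmodule.copy herm 'rV[R[i]]_d.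

Implicit Types u v w : herm.

(** The arguments are swapped because [dotmx] is linear in its first variable,
    while the inner product of a right module is linear in the second. *)
Definition hdot u v : R[i] := dotmx (v : 'rV_d) (u : 'rV_d).

Lemma hdotE u v : hdot u v = \sum_i (u 0 i)^* * v 0 i.
Proof.
rewrite /hdot dotmxE mxE; apply: eq_bigr => i _.
by rewrite !mxE mulrC.
Qed.

Lemma hdotDr u v w : hdot u (v + w) = hdot u v + hdot u w.
Proof. exact: linearDl. Qed.

Lemma hdotZr k u v : hdot u (k *: v) = k * hdot u v.
Proof. exact: linearZl_LR. Qed.

Lemma hdot_conj u v : (hdot u v)^* = hdot v u.
Proof.
rewrite !hdotE rmorph_sum; apply: eq_bigr => i _.
by rewrite rmorphM/= conjcK mulrC.
Qed.

Definition hnorm u : R[i] := sqrtC (hdot u u).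

Lemma hdot_ge0 u : 0 <= hdot u u.
Proof. exact: dnorm_ge0. Qed.

Lemma sqr_hnorm u : hnorm u ^+ 2 = hdot u u.
Proof. exact: sqrtCK. Qed.

Lemma hdot_eq0 u : hdot u u = 0 -> u = 0.
Proof. by move/eqP; rewrite /hdot dnorm_eq0 => /eqP. Qed.

Lemma hnorm_eq0 u : hnorm u = 0 -> u = 0.
Proof. by move=> u0; apply: hdot_eq0; rewrite -sqr_hnorm u0 expr0n. Qed.

Lemma hnormZ k u : hnorm (k *: u) = `|k| * hnorm u.
Proof.
by rewrite /hnorm /hdot dnormZ sqrtCM ?nnegrE ?exprn_ge0// ?sqrCK// dnorm_ge0.
Qed.

Lemma hnormD u v : hnorm (u + v) <= hnorm u + hnorm v.
Proof. exact: triangle_lerif. Qed.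

HB.instance Definition _ :=
  Lmodule_isNormed.Build R[i] herm hnormD hnormZ hnorm_eq0.

Lemma norm_hermE u : `|u| = hnorm u. Proof. by []. Qed.

Lemma ler_norm_hdot u v : `|hdot u v| <= `|u| * `|v|.
Proof. by rewrite mulrC; exact: CauchySchwarz_sqrt. Qed.

Lemma ler_coord_herm u i : `|u 0 i| <= `|u|.
Proof.
rewrite -(ler_pXn2r (n := 2)) ?nnegrE//.
rewrite norm_hermE sqr_hnorm hdotE (bigD1 i)//= sqr_normc mulrC lerDl.
rewrite sumr_ge0// => j _.
by rewrite mulrC mulcJ_ge0.
Qed.

Lemma herm_ler_sum u : `|u| <= \sum_i `|u 0 i|.
Proof.
rewrite -(ler_pXn2r (n := 2)) ?nnegrE ?sumr_ge0//.
rewrite norm_hermE sqr_hnorm hdotE expr2 mulr_suml ler_sum// => i _.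
rewrite mulrC -sqr_normc expr2 ler_wpM2l// (bigD1 i)//= lerDl.
exact: sumr_ge0.
Qed.

Lemma herm_cauchy_cvg (F : set_system herm) :
  ProperFilter F -> cauchy F -> cvg F.
Proof.
move=> FF cF.
pose ev i (u : herm) : complex_line R := u 0 i.
have cev i : cvg (ev i @ F).
  apply: cauchy_cvg; apply: cauchy_image cF => e e0; exists e => // u v.
  rewrite -!ball_normE; apply: le_lt_trans.
  by have := ler_coord_herm (u - v) i; rewrite !mxE.
pose l : herm := \row_i (lim (ev i @ F) : R[i]).
apply/cvg_ex; exists l; apply/cvgrPdist_le => e e0.
have ed : 0 < e / d.+1%:R by rewrite divr_gt0.
have /filter_forall : forall i, \forall u \near F,
    `|lim (ev i @ F) - ev i u| <= e / d.+1%:R.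
  by move=> i; move/cvgrPdist_le: (cev i); apply.
apply: filterS => u lu; apply: (le_trans (herm_ler_sum _)).
apply: (@le_trans _ _ (\sum_(i < d) e / d.+1%:R)).
  by apply: ler_sum => i _; rewrite !mxE; exact: lu.
rewrite sumr_const card_ord -[leLHS]mulr_natr -mulrA ler_piMr ?ltW//.
by rewrite mulrC ltr_pdivrMr// mul1r ltr_nat.
Qed.

HB.instance Definition _ := Uniform_isComplete.Build herm herm_cauchy_cvg.
End HermitianSpace.

(** * The C*-algebra of bounded complex functions *)

Section LinfNorms.
Variables (R : realType) (T : Type) (V W : normedModType R[i]).

(** Suprema commute with squares; both the C*-identity and the compatibility of
    the module norm with the inner product reduce to this. *)
Lemma linf_norm_sqr (f : linf T V) (g : linf T W) :
  (forall t, `|g t| = `|f t| ^+ 2) -> `|f| ^+ 2 = `|g|.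
Proof.
move=> gf; apply/le_anti/andP; split.
  rewrite -[leRHS]sqrtCK ler_pXn2r ?nnegrE ?sqrtC_ge0//.
  apply: linf_ler => [|t]; first by rewrite sqrtC_ge0.
  rewrite -(ler_pXn2r (n := 2)) ?nnegrE ?sqrtC_ge0// sqrtCK -gf.
  exact: ler_eval_linf.
apply: linf_ler => [|t]; first exact: exprn_ge0.
by rewrite gf ler_pXn2r ?nnegrE// ler_eval_linf.
Qed.

End LinfNorms.

Section BoundedScalars.
Variables (R : realType) (T : Type).
Local Notation A := (linf T (complex_line R)).

Lemma ler_eval_scalar (a : A) t : `|(a t : R[i])| <= `|a|.
Proof. exact (ler_eval_linf a t). Qed.

Lemma smul_bounded (a b : A) :
  (fun t => (a t : R[i]) * b t) \in @bounded_map R T (complex_line R).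
Proof.
apply/bounded_mapP; exists (`|a| * `|b|) => t.
rewrite -[`|_|]/(`|(a t : R[i]) * b t|) normrM.
by rewrite ler_pM// ler_eval_scalar.
Qed.

Lemma sconj_bounded (a : A) :
  (fun t => (a t : R[i])^*) \in @bounded_map R T (complex_line R).
Proof.
apply/bounded_mapP; exists `|a| => t.
rewrite -[`|_|]/(`|(a t : R[i])^*|) normcJ.
exact: ler_eval_scalar.
Qed.

Definition smul (a b : A) : A := Linf (smul_bounded a b).
Definition sconj (a : A) : A := Linf (sconj_bounded a).

(** The next lemmas evaluate operations of the algebra in the field [R[i]], where
    the field lemmas rewrite directly. *)
Lemma linf_complexP (a b : A) : (forall t, (a t : R[i]) = b t) -> a = b.
Proof. move=> ab; exact (@linfP R T (complex_line R) a b ab). Qed.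
Lemma linf_complexDE (a b : A) t :
  (a + b) t = (a t : R[i]) + (b t : R[i]) :> R[i].
Proof. exact (linfDE a b t). Qed.
Lemma linf_complexZE (k : R[i]) (a : A) t :
  (k *: a) t = k * (a t : R[i]) :> R[i].
Proof. exact (linfZE k a t). Qed.
Lemma smulE (a b : A) t : smul a b t = (a t : R[i]) * (b t : R[i]) :> R[i].
Proof. by []. Qed.
Lemma sconjE (a : A) t : sconj a t = (a t : R[i])^* :> R[i].
Proof. by []. Qed.

Lemma smul_normM (a b : A) : `|smul a b| <= `|a| * `|b|.
Proof.
apply: linf_ler => [|t]; first exact: mulr_ge0.
rewrite -[`|_|]/(`|(a t : R[i]) * b t|) normrM.
by rewrite ler_pM// ler_eval_scalar.
Qed.

Lemma smul_norm_star (a : A) : `|smul (sconj a) a| = `|a| ^+ 2.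
Proof.
apply/esym/linf_norm_sqr => t.
rewrite -[LHS]/(`|(a t : R[i])^* * a t|) normrM normcJ.
by rewrite expr2.
Qed.

Fact smulA a b c : smul a (smul b c) = smul (smul a b) c.
Proof.
by apply: linf_complexP => t; rewrite !smulE mulrA. Qed.
Fact smulDl a b c : smul (a + b) c = smul a c + smul b c.
Proof.
by apply: linf_complexP => t; rewrite smulE !linf_complexDE mulrDl. Qed.
Fact smulDr a b c : smul a (b + c) = smul a b + smul a c.
Proof.
by apply: linf_complexP => t; rewrite smulE !linf_complexDE mulrDr. Qed.
Fact smulZl (k : R[i]) a b : smul (k *: a) b = k *: smul a b.
Proof.
by apply: linf_complexP => t; rewrite smulE !linf_complexZE mulrA. Qed.
Fact smulZr (k : R[i]) a b : smul a (k *: b) = k *: smul a b.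
Proof.
by apply: linf_complexP => t; rewrite smulE !linf_complexZE mulrCA. Qed.
Fact sconjK a : sconj (sconj a) = a.
Proof.
by apply: linf_complexP => t; rewrite !sconjE conjcK. Qed.
Fact sconjD a b : sconj (a + b) = sconj a + sconj b.
Proof.
by apply: linf_complexP => t; rewrite !linf_complexDE !sconjE linf_complexDE rmorphD. Qed.
Fact sconjZ (k : R[i]) a : sconj (k *: a) = Num.conj k *: sconj a.
Proof.
by apply: linf_complexP => t; rewrite !linf_complexZE !sconjE linf_complexZE rmorphM. Qed.
Fact sconjM a b : sconj (smul a b) = smul (sconj b) (sconj a).
Proof.
by apply: linf_complexP => t; rewrite !(smulE, sconjE) rmorphM mulrC. Qed.

HB.instance Definition _ := isCStarAlgebra.Build R A smulA smulDl smulDr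
  smulZl smulZr sconjK sconjD sconjZ sconjM smul_normM smul_norm_star.

End BoundedScalars.

(** * The Hilbert module of bounded vector-valued functions *)

Section BoundedVectors.
Variables (R : realType) (T : Type) (d : nat).
Local Notation A := (linf T (complex_line R)).
Local Notation H := (linf T (herm R d)).

Lemma vact_bounded (x : H) (a : A) :
  (fun t => (a t : R[i]) *: x t) \in @bounded_map R T (herm R d).
Proof.
apply/bounded_mapP; exists (`|a| * `|x|) => t.
by rewrite normrZ ler_pM ?ler_eval_scalar ?ler_eval_linf.
Qed.

Lemma vdot_bounded (x y : H) :
  (fun t => hdot (x t) (y t)) \in @bounded_map R T (complex_line R).
Proof.
apply/bounded_mapP; exists (`|x| * `|y|) => t.
rewrite -[`|_|]/(`|hdot (x t) (y t)|) (le_trans (ler_norm_hdot _ _))//.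
by rewrite ler_pM// ler_eval_linf.
Qed.

Lemma vnorm_bounded (x : H) :
  (fun t => `|x t|) \in @bounded_map R T (complex_line R).
Proof.
apply/bounded_mapP; exists `|x| => t.
rewrite -[`|_|]/(`|(`|x t| : R[i])|) normr_id; exact: ler_eval_linf.
Qed.

Definition vact (x : H) (a : A) : H := Linf (vact_bounded x a).
Definition vdot (x y : H) : A := Linf (vdot_bounded x y).

Lemma vactE (x : H) (a : A) t : vact x a t = (a t : R[i]) *: x t.
Proof. by []. Qed.
Lemma vdotE (x y : H) t : vdot x y t = hdot (x t) (y t) :> R[i].
Proof. by []. Qed.

Fact vactDl x y a : vact (x + y) a = vact x a + vact y a.
Proof. by apply: linfP => t; rewrite linfDE !vactE linfDE scalerDr. Qed.
Fact vactDr x a b : vact x (a + b) = vact x a + vact x b.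
Proof. by apply: linfP => t; rewrite linfDE !vactE linf_complexDE scalerDl. Qed.
Fact vactM x a b : vact x (cmul a b) = vact (vact x a) b.
Proof. by apply: linfP => t; rewrite !vactE smulE scalerA mulrC. Qed.
Fact vactZl (k : R[i]) x a : vact (k *: x) a = k *: vact x a.
Proof. by apply: linfP => t; rewrite linfZE !vactE linfZE !scalerA mulrC. Qed.
Fact vactZr (k : R[i]) x a : vact x (k *: a) = k *: vact x a.
Proof. by apply: linfP => t; rewrite linfZE !vactE linf_complexZE scalerA. Qed.
Fact vdotDr x y z : vdot x (y + z) = vdot x y + vdot x z.
Proof.
by apply: linf_complexP => t; rewrite linf_complexDE !vdotE linfDE hdotDr. Qed.
Fact vdotZr (k : R[i]) x y : vdot x (k *: y) = k *: vdot x y.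
Proof.
by apply: linf_complexP => t; rewrite linf_complexZE !vdotE linfZE hdotZr. Qed.
Fact vdot_vact x y a : vdot x (vact y a) = cmul (vdot x y) a.
Proof.
by apply: linf_complexP => t; rewrite smulE !vdotE vactE hdotZr mulrC. Qed.
Fact vdot_star x y : cstar (vdot x y) = vdot y x.
Proof.
by apply: linf_complexP => t; rewrite sconjE !vdotE hdot_conj. Qed.
Fact vdot_ge0 x : cpositive (vdot x x).
Proof.
exists (Linf (vnorm_bounded x)); apply: linf_complexP => t.
have nE : Linf (vnorm_bounded x) t = `|x t| :> R[i] by [].
have cE : (`|x t| : R[i])^* = `|x t| := geC0_conj (normr_ge0 (x t)).
rewrite smulE sconjE vdotE nE cE -expr2.
by rewrite norm_hermE sqr_hnorm.
Qed.
Fact vdot_eq0 x : vdot x x = 0 -> x = 0.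
Proof.
move=> xx; apply: linfP => t; apply: hdot_eq0.
by rewrite -[LHS]/(vdot x x t) xx.
Qed.
Fact norm_vdot x : `|x| ^+ 2 = `|vdot x x|.
Proof.
apply: linf_norm_sqr => t.
rewrite norm_hermE sqr_hnorm -[LHS]/(`|hdot (x t) (x t)|).
by rewrite ger0_norm// hdot_ge0.
Qed.

HB.instance Definition _ := isHilbertModule.Build R A H vactDl vactDr vactM
  vactZl vactZr vdotDr vdotZr vdot_vact vdot_star vdot_ge0 vdot_eq0 norm_vdot.

End BoundedVectors.

(** * Ranges of operators on Hilbert modules *)

Section OntoOperators.
Variables (R : realType) (A : cstarAlgType R) (H : hilbertModType A).

Lemma setT_orthogonally_complemented :
  orthogonally_complemented (setT : set H).
Proof.
apply/seteqP; split=> // x _; exists x => //; exists 0; last by rewrite addr0.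
move=> y _; rewrite -inner_star.
have -> : inner y 0 = 0 :> A.
  by have := innerZr (0 : R[i]) y (0 : H); rewrite !scale0r.
by have := cstarZ (0 : R[i]) (0 : A); rewrite scale0r rmorph0 scale0r.
Qed.

Lemma onto_orthogonally_complemented (f : H -> H) :
  range f = setT -> orthogonally_complemented (closure (range f)).
Proof. by move=> ->; rewrite closureT; exact: setT_orthogonally_complemented. Qed.

(** Because [<f z, f z> = <z, f (f z)>], where [f (f z)] is in the range. *)
Lemma orthogonal_range_selfadjoint (f : H -> H) z :
  is_adjoint f f -> orthogonal_complement (closure (range f)) z -> f z = 0.
Proof.
move=> ff fz; apply: inner_eq0; rewrite ff; apply: fz.
by apply: subset_closure; exists (f z).
Qed.

End OntoOperators.

(** * Operators given by families of matrices *)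

Section FibrewiseOperators.
Variables (R : realType) (T : Type) (d : nat).
Local Notation H := (linf T (herm R d)).
Implicit Types (f g : H -> H) (M N : T -> 'M[R[i]]_d).

Definition fibrewise f M :=
  forall x t, f x t = (x t : 'rV_d) *m M t.

Definition mx_bounded M := exists c : R[i], forall t i j, `|M t i j| <= c.

Lemma mulmx_bounded M (x : H) : mx_bounded M ->
  (fun t => (x t : 'rV_d) *m M t) \in @bounded_map R T (herm R d).
Proof.
move=> [c Mc]; apply/bounded_mapP.
exists (\sum_(i < d) \sum_(j < d) `|x| * c) => t.
apply: le_trans (herm_ler_sum _) _; apply: ler_sum => i _.
rewrite mxE; apply: le_trans (ler_norm_sum _ _ _) _; apply: ler_sum => j _.
rewrite normrM ler_pM//.
exact: le_trans (ler_coord_herm _ _) (ler_eval_linf _ _).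
Qed.

Lemma fibrewise_exists M : mx_bounded M -> exists f, fibrewise f M.
Proof. by move=> Mb; exists (fun x => Linf (mulmx_bounded x Mb)). Qed.

Lemma fibrewise_id : fibrewise idfun (fun=> 1%:M).
Proof. by move=> x t; rewrite mulmx1. Qed.

Lemma fibrewiseD f g M N : fibrewise f M -> fibrewise g N ->
  fibrewise (f + g) (fun t => M t + N t).
Proof. by move=> fM gN x t; rewrite mulmxDr -fM -gN. Qed.

Lemma fibrewiseB f g M N : fibrewise f M -> fibrewise g N ->
  fibrewise (f - g) (fun t => M t - N t).
Proof. by move=> fM gN x t; rewrite mulmxBr -fM -gN. Qed.

Lemma fibrewise_selfadjoint f M : fibrewise f M ->
  (forall t, map_mx Num.conj (M t)^T = M t) -> is_adjoint f f.
Proof.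
move=> fM Mh x y; suff: vdot (f x) y = vdot x (f y) by [].
apply: linf_complexP => t; rewrite !vdotE !fM.
by rewrite /hdot !dotmxE trmx_mul map_mxM/= mulmxA Mh.
Qed.

Lemma fibrewise_projection f M : fibrewise f M ->
  (forall t, map_mx Num.conj (M t)^T = M t) ->
  (forall t, M t *m M t = M t) -> projection f.
Proof.
move=> fM Mh MM; have ff := fibrewise_selfadjoint fM Mh.
split=> //; first by exists f.
by apply/funext => x; apply: linfP => t; rewrite /= !fM -mulmxA MM.
Qed.

(** The inverse family must be bounded: otherwise it does not map bounded vectors
    to bounded vectors. *)
Lemma fibrewise_onto f M N : fibrewise f M -> mx_bounded N ->
  (forall t, N t *m M t = 1%:M) -> range f = setT.
Proof.
move=> fM Nb NM; apply/seteqP; split=> // y _.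
have [g gN] := fibrewise_exists Nb.
by exists (g y) => //; apply: linfP => t; rewrite fM gN -mulmxA NM mulmx1.
Qed.

(** In contrast with surjectivity, the inverses may be unbounded here. *)
Lemma fibrewise_inj0 f M N x : fibrewise f M ->
  (forall t, M t *m N t = 1%:M) -> f x = 0 -> x = 0.
Proof.
move=> fM MN fx; apply: linfP => t.
by rewrite -[LHS]mulmx1 -(MN t) mulmxA -fM fx mul0mx.
Qed.

End FibrewiseOperators.

(** * Symmetric 2 x 2 matrices *)

Section Sym2.
Variable R : realType.

Definition sym2 (a b c : R[i]) : 'M[R[i]]_2 :=
  \matrix_(i, j) if i != j then b else if i == 0 then a else c.

Lemma sym2_hermitian a b c :
  a \is Num.real -> b \is Num.real -> c \is Num.real ->
  map_mx Num.conj (sym2 a b c)^T = sym2 a b c.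
Proof.
move=> ar br cr; apply/matrixP => i j; rewrite !mxE eq_sym.
by case: eqVneq => [->|_]; [case: ifP => _|]; exact: conj_Creal.
Qed.

(** The hypothesis says that the two matrices commute, which is when their product
    is symmetric. *)
Lemma mulmx_sym2 a b c a' b' c' :
  a * b' + b * c' = b * a' + c * b' ->
  sym2 a b c *m sym2 a' b' c' =
  sym2 (a * a' + b * b') (a * b' + b * c') (b * b' + c * c').
Proof.
move=> sym; apply/matrixP => i j; rewrite !mxE.
rewrite !big_ord_recl big_ord0 !mxE addr0.
by case: i j => [[|[|//]] i] [[|[|//]] j] /=.
Qed.

Lemma sym2D a b c a' b' c' :
  sym2 a b c + sym2 a' b' c' = sym2 (a + a') (b + b') (c + c').
Proof.
by apply/matrixP => i j; rewrite !mxE; case: eqVneq => //= _; case: ifP.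
Qed.

Lemma sym2N a b c : - sym2 a b c = sym2 (- a) (- b) (- c).
Proof.
by apply/matrixP => i j; rewrite !mxE; case: eqVneq => //= _; case: ifP.
Qed.

Lemma sym2_1 : 1%:M = sym2 1 0 1.
Proof.
by apply/matrixP => i j; rewrite !mxE; case: eqVneq => //= _; case: ifP.
Qed.

Lemma sym2_bounded T (a b c : T -> R[i]) (k : R[i]) :
  (forall t, `|a t| <= k) -> (forall t, `|b t| <= k) ->
  (forall t, `|c t| <= k) -> mx_bounded (fun t => sym2 (a t) (b t) (c t)).
Proof.
move=> ak bk ck; exists k => t i j.
by rewrite mxE; case: ifP => // _; case: ifP.
Qed.

End Sym2.

(** * The pair of projections *)

Section Counterexample.
Variable R : realType.
Local Notation H := (linf nat (herm R 2)).

Definition slope (n : nat) : R[i] := n.+1%:R^-1.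
Local Notation s := slope.

(** The orthogonal projection onto the line spanned by [(1, 0)]. *)
Definition axis_mx (n : nat) : 'M[R[i]]_2 := sym2 1 0 0.

(** The orthogonal projection onto the line spanned by [(s n, 1)]. *)
Definition tilted_mx (n : nat) : 'M[R[i]]_2 :=
  sym2 (s n ^+ 2 / (1 + s n ^+ 2)) (s n / (1 + s n ^+ 2)) (1 + s n ^+ 2)^-1.

Lemma slope_gt0 n : 0 < s n. Proof. by rewrite invr_gt0. Qed.

Lemma slope_neq0 n : s n != 0. Proof. by rewrite gt_eqF// slope_gt0. Qed.

Lemma slope_le1 n : s n <= 1.
Proof. by rewrite invf_le1// ler1n. Qed.

Lemma slope_real n : s n \is Num.real.
Proof. by rewrite gtr0_real// slope_gt0. Qed.

Lemma slope_den_gt0 n : 0 < 1 + s n ^+ 2.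
Proof. by rewrite addr_gt0 ?exprn_gt0 ?slope_gt0. Qed.

Lemma slope_den_neq0 n : 1 + s n ^+ 2 != 0.
Proof. by rewrite gt_eqF// slope_den_gt0. Qed.

Lemma slope_sqr_le1 n : s n ^+ 2 <= 1.
Proof. by rewrite expr_le1// ?slope_le1// ltW ?slope_gt0. Qed.

Lemma norm_slope_div n (x : R[i]) : 0 <= x -> `|x / (1 + s n ^+ 2)| <= x.
Proof.
move=> x0; rewrite ger0_norm ?divr_ge0 ?(ltW (slope_den_gt0 n))//.
rewrite ler_pdivrMr ?slope_den_gt0// mulrDr mulr1 lerDl mulr_ge0//.
by rewrite exprn_ge0// ltW ?slope_gt0.
Qed.

Lemma norm_slope_num n : `|1 + 2 * s n ^+ 2| <= 3.
Proof.
have s2 : 0 <= s n ^+ 2 by rewrite exprn_ge0// ltW ?slope_gt0.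
rewrite ger0_norm; last by rewrite addr_ge0// mulr_ge0.
rewrite -[3]/((1 + 2)%:R) natrD lerD// -[leRHS]mulr1 ler_wpM2l//.
exact: slope_sqr_le1.
Qed.

Lemma axis_bounded : mx_bounded axis_mx.
Proof. by apply: (@sym2_bounded _ _ _ _ _ 1) => t; rewrite ?normr1 ?normr0. Qed.

Lemma tilted_bounded : mx_bounded tilted_mx.
Proof.
apply: (@sym2_bounded _ _ _ _ _ 1) => t.
- apply: le_trans (slope_sqr_le1 t); apply: norm_slope_div.
  by rewrite exprn_ge0// ltW ?slope_gt0.
- by apply: le_trans (slope_le1 t); apply/norm_slope_div/ltW/slope_gt0.
- by rewrite -[_^-1]mul1r norm_slope_div.
Qed.

Lemma axis_hermitian t : map_mx Num.conj (axis_mx t)^T = axis_mx t.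
Proof. by apply: sym2_hermitian; rewrite ?real1 ?real0. Qed.

Lemma tilted_hermitian t : map_mx Num.conj (tilted_mx t)^T = tilted_mx t.
Proof.
by apply: sym2_hermitian;
  rewrite ?realM ?realV ?realD ?rpredX ?real1 ?slope_real.
Qed.

Lemma axis_idempotent t : axis_mx t *m axis_mx t = axis_mx t.
Proof.
rewrite mulmx_sym2; first by congr sym2; ring.
by ring.
Qed.

Lemma tilted_idempotent t : tilted_mx t *m tilted_mx t = tilted_mx t.
Proof.
have den0 := slope_den_neq0 t; rewrite mulmx_sym2; last by field.
by congr sym2; field.
Qed.

Variables P Q : H -> H.
Hypothesis fP : fibrewise P axis_mx.
Hypothesis fQ : fibrewise Q tilted_mx.

Lemma sum_range_onto : range (P + Q) = setT.
Proof.
apply: (fibrewise_onto (N := fun t => sym2 1 (- s t) (1 + 2 * s t ^+ 2))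
  (fibrewiseD fP fQ)).
  apply: (@sym2_bounded _ _ _ _ _ 3) => t.
  - by rewrite normr1 ler1n.
  - rewrite normrN (ger0_norm (ltW (slope_gt0 t))) (le_trans (slope_le1 t))//.
    by rewrite ler1n.
  - exact: norm_slope_num.
move=> t; have den0 := slope_den_neq0 t.
rewrite sym2D mulmx_sym2; last by field.
by rewrite sym2_1; congr sym2; field.
Qed.

Lemma cosum_range_onto : range (idfun *+ 2 - P - Q) = setT.
Proof.
have fI := @fibrewise_id R nat 2.
apply: (fibrewise_onto (N := fun t => sym2 (1 + 2 * s t ^+ 2) (s t) 1)
  (fibrewiseB (fibrewiseB (fibrewiseD fI fI) fP) fQ)).
  apply: (@sym2_bounded _ _ _ _ _ 3) => t.
  - exact: norm_slope_num.
  - rewrite (ger0_norm (ltW (slope_gt0 t))) (le_trans (slope_le1 t))//.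
    by rewrite ler1n.
  - by rewrite normr1 ler1n.
move=> t; have den0 := slope_den_neq0 t.
rewrite sym2_1 !sym2N !sym2D mulmx_sym2; last by field.
by congr sym2; field.
Qed.

(** The fibre at [t] is that of [P + (I - Q)] after simplification; as [s t] tends
    to 0, it tends to the singular matrix [sym2 2 0 0]. *)
Lemma fibrewise_cross : fibrewise (P + (idfun - Q))
  (fun t => sym2 (1 + (1 + s t ^+ 2)^-1) (- (s t / (1 + s t ^+ 2)))
                 (s t ^+ 2 / (1 + s t ^+ 2))).
Proof.
move=> x t; rewrite (fibrewiseD fP (fibrewiseB (@fibrewise_id R nat 2) fQ)).
have den0 := slope_den_neq0 t.
by congr mulmx; rewrite sym2_1 sym2N !sym2D; congr sym2; field.
Qed.

Lemma cross_selfadjoint : is_adjoint (P + (idfun - Q)) (P + (idfun - Q)).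
Proof.
apply: fibrewise_selfadjoint fibrewise_cross _ => t.
by apply: sym2_hermitian;
  rewrite ?realN ?realD ?realM ?realV ?realD ?rpredX ?real1 ?slope_real.
Qed.

(** The determinant of the fibre at [t] is [s t ^+ 2 / (1 + s t ^+ 2)]: nonzero,
    but not bounded away from 0. *)
Lemma cross_inj0 z : (P + (idfun - Q)) z = 0 -> z = 0.
Proof.
apply: (fibrewise_inj0
  (N := fun t => sym2 1 (s t)^-1 ((2 + s t ^+ 2) / s t ^+ 2))
  fibrewise_cross) => t.
have den0 := slope_den_neq0 t; have s0 := slope_neq0 t.
rewrite mulmx_sym2; last by field; rewrite den0 s0.
by rewrite sym2_1; congr sym2; field; rewrite den0 s0.
Qed.

(** The obstruction: both entries in the second column are at most [s n]. *)
Lemma ler_cross (x : H) n :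
  `|((P + (idfun - Q)) x n : 'rV_2) 0 1| <= 2 * (`|x| * s n).
Proof.
rewrite fibrewise_cross mxE !big_ord_recl big_ord0 addr0 !mxE /=.
have s0 := ltW (slope_gt0 n).
have xn i : `|(x n : 'rV_2) 0 i| <= `|x|.
  exact: le_trans (ler_coord_herm _ _) (ler_eval_linf _ _).
apply: le_trans (ler_normD _ _) _.
rewrite mulr_natl mulr2n; apply: lerD; rewrite normrM ler_pM//.
  by rewrite normrN norm_slope_div.
apply: le_trans (norm_slope_div _ (exprn_ge0 _ s0)) _.
by rewrite expr2 ler_piMl// slope_le1.
Qed.

Lemma second_axis_bounded :
  (fun=> delta_mx 0 1 : 'rV[R[i]]_2) \in @bounded_map R nat (herm R 2).
Proof. by apply/bounded_mapP; exists `|delta_mx 0 1 : herm R 2|. Qed.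

Lemma cross_not_complemented :
  ~ orthogonally_complemented (closure (range (P + (idfun - Q)))).
Proof.
move=> SC; pose e : H := Linf second_axis_bounded.
have [y Sy [z Sz yz]] : [set y + z | y in closure (range (P + (idfun - Q))) &
    z in orthogonal_complement (closure (range (P + (idfun - Q))))] e.
  by rewrite SC.
have z0 : z = 0.
  exact/cross_inj0/(orthogonal_range_selfadjoint cross_selfadjoint).
have {yz z0} ye : y = e by rewrite -yz z0 addr0.
have half0 : 0 < 2^-1 :> R[i] by rewrite invr_gt0.
have [_ [[x _ <-]]] := Sy _ (nbhsx_ballx y _ half0).
rewrite -ball_normE ye /= => eSx.
pose r := complex.Re `|x|.
have rx : `|x| = r%:C by rewrite RRe_real.
have r0 : 0 <= r by rewrite -ler0c -rx.
pose n := Num.bound (4 * r).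
have rn : 4 * r < n%:R by apply: archi_boundP; rewrite mulr_ge0.
have xn : 4 * `|x| <= n.+1%:R.
  rewrite rx -(rmorph_nat (real_complex R) 4) -rmorphM.
  rewrite -(rmorph_nat (real_complex R) n.+1) lecR (le_trans (ltW rn))//.
  by rewrite ler_nat.
(* At such an [n], [S x] has second coordinate at most 1/2, while it is within
   less than 1/2 of [e], whose second coordinate is 1. *)
have small : 2 * (`|x| * s n) <= 2^-1.
  have -> : 2 * (`|x| * s n) = (4 * `|x|) / n.+1%:R * 2^-1.
    by rewrite /slope; move: (n.+1%:R^-1) => k; field.
  by rewrite ler_piMl ?(ltW half0)// ler_pdivrMr// mul1r.
have e1 : (e n : 'rV_2) 0 1 = 1 by rewrite mxE.
have := le_lt_trans (ler_coord_herm ((e - (P + (idfun - Q)) x) n) 1)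
  (le_lt_trans (ler_eval_linf _ n) eSx).
rewrite linfDE linfNE mxE [X in _ + X]mxE e1 => near1.
have : 1 < 1 :> R[i].
  rewrite {2}(splitr 1) mul1r.
  apply: le_lt_trans (ltr_leD near1 (le_trans (ler_cross x n) small)).
  rewrite -[leLHS]normr1 -{1}(subrK (((P + (idfun - Q)) x n : 'rV_2) 0 1) 1).
  exact: ler_normD.
by rewrite ltxx.
Qed.


End Counterexample.

Theorem theorem2p5 (R : realType) :
  exists (A : cstarAlgType R) (H : hilbertModType A) (P Q : H -> H),
    [/\ projection P, projection Q, semi_harmonious P Q & ~ harmonious P Q].
Proof.
have [P fP] := fibrewise_exists (@axis_bounded R).
have [Q fQ] := fibrewise_exists (@tilted_bounded R).
exists (linf nat (complex_line R)), (linf nat (herm R 2)), P, Q; split.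
- exact: fibrewise_projection fP (@axis_hermitian R) (@axis_idempotent R).
- exact: fibrewise_projection fQ (@tilted_hermitian R) (@tilted_idempotent R).
- split; apply: onto_orthogonally_complemented.
    exact: sum_range_onto fP fQ.
  exact: cosum_range_onto fP fQ.
- by case=> _ [/(cross_not_complemented fP fQ)].
Qed.
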